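(* Let $L\in\mathbb{R}^{\nu\times\nu}\langle x,x^*\rangle$ be a linear pencil, let $I\subseteq\mathbb{R}^{1\times\ell}\langle x,x^*\rangle$ be a finitely generated left module, and let $p\in\mathbb{R}^{1\times\ell}\langle x,x^*\rangle$. Then $p(X)v=0$ for every $(X,v)\in V(I)$ with $L(X)\succeq0$ if and only if $p\in\sqrt[(L)]{I}$.
   Context: Let $x=(x_1,\dots,x_g)$, let $\langle x,x^*\rangle$ be the free monoid on the $2g$ letters $x_1,\dots,x_g,x_1^*,\dots,x_g^*$ (the empty word is $1$), and let $\mathbb{R}\langle x,x^*\rangle$ be the free real algebra on it, with the linear involution $*$ exchanging $x_i$ and $x_i^*$ and satisfying $(pq)^*=q^*p^*$. Elements of $\mathbb{R}^{\nu\times\ell}\langle x,x^*\rangle$ (matrices over $\mathbb{R}\langle x,x^*\rangle$) are written $p=\sum_w A_w\otimes w$; $p^*=\sum_w A_w^*\otimes w^*$, where $A^*$ is the transpose; $p$ is symmetric if $p=p^*$. For a tuple $X=(X_1,\dots,X_g)$ of real $n\times n$ matrices, $p(X)=\sum_w A_w\otimes w(X)$ (Kronecker product), with $x_i\mapsto X_i$, $x_i^*\mapsto X_i^*$ (transpose), empty word $\mapsto\mathrm{Id}_n$. A linear pencil is a symmetric square matrix polynomial $L$ of degree at most $1$. A left module is a left $\mathbb{R}\langle x,x^*\rangle$-submodule $I$ of $\mathbb{R}^{1\times\ell}\langle x,x^*\rangle$ (entrywise left multiplication). $\mathbb{R}^{a\times1}I$ denotes the $a\times\ell$ matrices all of whose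 rows lie in $I$, and $I^*\mathbb{R}^{1\times\ell}=(\mathbb{R}^{\ell\times1}I)^*$. $V(I)$ is the set of all pairs $(X,v)\in(\mathbb{R}^{n\times n})^g\times\mathbb{R}^{\ell n}$, $n\in\mathbb{N}$ arbitrary, with $\iota(X)v=0$ for all $\iota\in I$. A left module $I$ is $L$-real if whenever $\sum_i^{\rm finite}p_i^*p_i+\sum_j^{\rm finite}q_j^*Lq_j\in\mathbb{R}^{\ell\times1}I+I^*\mathbb{R}^{1\times\ell}$ with $p_i\in\mathbb{R}^{1\times\ell}\langle x,x^*\rangle$ and $q_j\in\mathbb{R}^{\nu\times\ell}\langle x,x^*\rangle$, then each $p_i\in I$ and each $Lq_j\in\mathbb{R}^{\nu\times1}I$. The $L$-real radical $\sqrt[(L)]{I}$ is the intersection of all $L$-real left modules containing $I$ (the smallest such). *)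

(* Defs.v *)
From mathcomp Require Import all_boot all_order all_algebra.
From mathcomp Require Import finmap.
From mathcomp.multinomials Require Import monalg.
From mathcomp.real_closed Require Import mxtens.
From mathcomp Require Import boolp classical_sets reals.

Set Implicit Arguments.
Unset Strict Implicit.
Unset Printing Implicit Defensive.

Import Order.TTheory GRing.Theory Num.Theory.
Local Open Scope classical_set_scope.
Local Open Scope ring_scope.

(* [inl i] is the letter x_i and [inr i] is the letter x_i^*. *)
Definition letter (g : nat) := ('I_g + 'I_g)%type.

Notation word g := {fmonom (letter g)}.

Notation "{ 'ncpoly' R [ g ] }" := {malg R[word g]}
  (at level 0, R, g at level 2, format "{ 'ncpoly'  R [ g ] }") : type_scope.

Definition letter_star (g : nat) (a : letter g) : letter g :=
  match a with inl i => inr i | inr i => inl i end.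

Definition word_star (g : nat) (w : word g) : word g :=
  FMonom (rev (map (@letter_star g) w)).

Section NCPoly.
Variables (R : realType) (g : nat).

Definition ncstar (a : {ncpoly R[g]}) : {ncpoly R[g]} :=
  \sum_(w <- msupp a) << a@_w *g word_star w >>.

(* If p = \sum_w A_w (x) w, then the (i, j) entry of p^* = \sum_w A_w^T (x) w^*
   is the involution applied to the (j, i) entry of p. *)
Definition mxstar (a b : nat) (p : 'M[{ncpoly R[g]}]_(a, b)) :
    'M[{ncpoly R[g]}]_(b, a) :=
  map_mx ncstar p^T.

Definition mxcoef (a b : nat) (w : word g) (p : 'M[{ncpoly R[g]}]_(a, b)) :
    'M[R]_(a, b) :=
  map_mx (mcoeff w) p.

Definition mxsupp (a b : nat) (p : 'M[{ncpoly R[g]}]_(a, b)) : {fset word g} :=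
  \big[fsetU/fset0]_(i < a) \big[fsetU/fset0]_(j < b) msupp (p i j).

Definition letter_eval (n : nat) (X : 'I_g -> 'M[R]_n) (a : letter g) :
    'M[R]_n :=
  match a with inl i => X i | inr i => (X i)^T end.

Definition word_eval (n : nat) (X : 'I_g -> 'M[R]_n) (w : word g) : 'M[R]_n :=
  \prod_(a <- (w : seq (letter g))) letter_eval X a.

(* [*t] is the Kronecker product. *)
Definition mxeval (n : nat) (X : 'I_g -> 'M[R]_n) (a b : nat)
    (p : 'M[{ncpoly R[g]}]_(a, b)) : 'M[R]_(a * n, b * n) :=
  \sum_(w <- mxsupp p) (mxcoef w p *t word_eval X w).

Definition linear_pencil (nu : nat) (L : 'M[{ncpoly R[g]}]_nu) : Prop :=
  mxstar L = L /\
  forall (i j : 'I_nu) (w : word g), w \in msupp (L i j) -> (fdeg w <= 1)%N.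

(* The scaling of ['rV[{ncpoly R[g]}]_l] is entrywise left multiplication. *)
Definition left_module (l : nat) (I : set 'rV[{ncpoly R[g]}]_l) : Prop :=
  GRing.submod_closed [in I].

Definition fg_left_module (l : nat) (I : set 'rV[{ncpoly R[g]}]_l) : Prop :=
  exists (k : nat) (b : 'I_k -> 'rV[{ncpoly R[g]}]_l),
    I = [set u | exists c : 'I_k -> {ncpoly R[g]}, u = \sum_i c i *: b i].

Definition rows_in (l a : nat) (I : set 'rV[{ncpoly R[g]}]_l) :
    set 'M[{ncpoly R[g]}]_(a, l) :=
  [set A | forall i : 'I_a, I (row i A)].
Arguments rows_in {l} a I.

(* R^{l x 1} I + I^* R^{1 x l} *)
Definition sym_span (l : nat) (I : set 'rV[{ncpoly R[g]}]_l) :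
    set 'M[{ncpoly R[g]}]_l :=
  [set A + B | A in rows_in l I & B in [set mxstar C | C in rows_in l I]].

Definition ncvariety (l : nat) (I : set 'rV[{ncpoly R[g]}]_l) (n : nat) :
    set (('I_g -> 'M[R]_n) * 'cV[R]_(l * n)) :=
  [set Xv | forall iota, I iota -> mxeval Xv.1 iota *m Xv.2 = 0].
Arguments ncvariety {l} I n.

Definition Lreal (nu l : nat) (L : 'M[{ncpoly R[g]}]_nu)
    (I : set 'rV[{ncpoly R[g]}]_l) : Prop :=
  left_module I /\
  forall (s t : nat) (p : 'I_s -> 'rV[{ncpoly R[g]}]_l)
         (q : 'I_t -> 'M[{ncpoly R[g]}]_(nu, l)),
    sym_span I (\sum_i mxstar (p i) *m p i
                + \sum_j mxstar (q j) *m L *m q j) ->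
    (forall i, I (p i)) /\ (forall j, rows_in nu I (L *m q j)).

Definition Lradical (nu l : nat) (L : 'M[{ncpoly R[g]}]_nu)
    (I : set 'rV[{ncpoly R[g]}]_l) : set 'rV[{ncpoly R[g]}]_l :=
  \bigcap_(J in [set J | Lreal L J /\ I `<=` J]) J.

End NCPoly.

Arguments rows_in {R g l} a I _.
Arguments ncvariety {R g l} I n _.

Definition psdmx (R : realType) (m : nat) (M : 'M[R]_m) : Prop :=
  M^T = M /\ forall u : 'cV[R]_m, 0 <= (u^T *m M *m u) 0 0.

(* Main.v *)
From HB Require Import structures.
Require Import Defs.
From mathcomp Require Import all_boot all_order all_algebra.
From mathcomp Require Import finmap.
From mathcomp.multinomials Require Import monalg.
From mathcomp.real_closed Require Import mxtens.
From mathcomp Require Import boolp classical_sets reals.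
From mathcomp Require Import ring lra.
From mathcomp Require Import topology normedtype derive realfun.

(** One direction is a computation.  Fix a pair (X, v) with L(X) positive
    semidefinite.  If a sum of terms p_i^* p_i and q_j^* L q_j lies in the
    symmetric span of the left module of all q with q(X) v = 0, then its
    quadratic form vanishes at v.  That value is a sum of the nonnegative
    numbers |p_i(X) v|^2 and <L(X) q_j(X) v, q_j(X) v>, so p_i(X) v = 0 and
    L(X) q_j(X) v = 0 for all i and j: the module is L-real
    ([eval_kernel_Lreal]).  Hence it contains the L-real radical of any module
    that vanishes at (X, v).

    For the converse it suffices to show that, for every L-real left module J
    and every degree bound m, there is a pair (X, v) with L(X) positive
    semidefinite such that, among the rows q of degree at most m, exactly those
    in J satisfy q(X) v = 0 ([Lreal_representation]).  Applied to an L-real module containing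
    I, with m bounding the degrees of p and of finitely many generators of I,
    this places (X, v) in V(I), and p(X) v = 0 then says that p lies in J.

    The pair comes from a truncated GNS construction.  Let V be the space of
    rows of degree at most m.  A linear functional phi on l x l matrices is
    wanted that kills the symmetric span of J in degree at most 2m+1, is
    nonnegative on q^* L q and strictly positive on q^* q for q in V outside J.
    Modulo the symmetric span, the weighted sums of squares are the linear
    images of positive semidefinite matrices Z = G^T G, and L-reality says
    that no nonzero Z is mapped to 0.  The image of the compact base
    {tr Z = 1} is therefore a compact convex set that misses 0, and its point
    of least norm defines the functional ([psd_separation], [Lreal_state]).

    The form phi(p^* q) is then an inner product on V / J.  Take X_i to be
    multiplication by x_i followed by the orthogonal projection back to
    V / J, and v the column of classes of the unit rows.  No information is
    lost up to degree m, so q(X) v is the class of q for q in V.  Since L has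
    degree 1 and phi is controlled up to degree 2m+1, the projections do not
    interfere with the quadratic form of L(X), whose values are numbers
    phi(q^* L q) with q of degree at most m ([psd_gns]). *)

Set Implicit Arguments.
Unset Strict Implicit.
Unset Printing Implicit Defensive.

Import Order.TTheory GRing.Theory Num.Theory.
Import numFieldNormedType.Exports.
Local Open Scope classical_set_scope.
Local Open Scope ring_scope.

(** * Separating the positive semidefinite cone from a subspace *)

Section Separation.
Variable R : realType.

Lemma trmx11 (A : 'M[R]_1) : A^T = A.
Proof. by rewrite [A]mx11_scalar tr_scalar_mx. Qed.

Lemma quad_block n (a x : R) (b : 'rV[R]_n) (D : 'M[R]_n) (v : 'cV[R]_n) :
  ((col_mx x%:M v)^T *m block_mx a%:M b b^T D *m col_mx x%:M v) 0 0
  = a * x ^+ 2 + 2 * x * (b *m v) 0 0 + (v^T *m D *m v) 0 0.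
Proof.
rewrite tr_col_mx mul_row_block mul_row_col tr_scalar_mx.
rewrite !mulmxDl -!scalar_mxM mul_scalar_mx -scalemxAl.
rewrite -mulmxA mul_mx_scalar -scalemxAr.
rewrite -[v^T *m b^T]trmx_mul trmx11 !mxE eqxx !mulr1n.
ring.
Qed.

(** Cholesky factorization, by induction on the size.  The Schur complement of
    the upper left entry a is again positive semidefinite.  When a = 0 the rest
    of the first row is forced to vanish, so the formulas below remain correct
    with the convention 0^-1 = 0. *)
Lemma psd_gram n (Z : 'M[R]_n) : psdmx Z -> exists G : 'M[R]_n, Z = G^T *m G.
Proof.
elim: n Z => [|n IHn] Z [Zsym Zpos].
  by exists 0; rewrite [LHS]flatmx0 [RHS]flatmx0.
pose Z' : 'M_(1 + n) := Z.
have [a [b [D [ZE Dsym]]]] : exists (a : R) (b : 'rV_n) (D : 'M_n),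
    Z' = block_mx a%:M b b^T D /\ D^T = D.
  exists (ulsubmx Z' 0 0), (ursubmx Z'), (drsubmx Z').
  split; last by rewrite trmx_drsub [Z'^T]Zsym.
  rewrite -[LHS]submxK; congr block_mx; first exact: mx11_scalar.
  by rewrite trmx_ursub [Z'^T]Zsym.
have Zq (x : R) (v : 'cV[R]_n) :
    0 <= a * x ^+ 2 + 2 * x * (b *m v) 0 0 + (v^T *m D *m v) 0 0.
  by rewrite -quad_block -ZE; exact: Zpos.
have a_ge0 : 0 <= a.
  by have := Zq 1 0; rewrite !mulmx0 !mxE expr1n mulr1 mulr0 !addr0.
have b0 : a = 0 -> b = 0.
  move=> a0; apply/matrixP=> i j; rewrite (ord1 i) [RHS]mxE.
  pose d : 'cV[R]_n := delta_mx j 0.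
  have bj : (b *m d) 0 0 = b 0 j by rewrite -colE mxE.
  apply/eqP; apply: contraT => bj0.
  (* The form is affine in x with slope 2 b 0 j; at this x it is negative. *)
  have := Zq (- (d^T *m D *m d) 0 0 / b 0 j - (b 0 j)^-1) d.
  rewrite bj a0 mul0r add0r.
  have := Zq 0 d; rewrite bj a0.
  set c := (_ *m _ *m _) 0 0 => cd.
  have -> : 2 * (- c / b 0 j - (b 0 j)^-1) * b 0 j = - 2 * (c + 1) by field.
  lra.
have [] := IHn (D - a^-1 *: (b^T *m b)).
  split; first by rewrite linearB linearZ /= trmx_mul trmxK Dsym.
  (* This x minimizes the quadratic polynomial in x. *)
  move=> v; have := Zq (- a^-1 * (b *m v) 0 0) v.
  rewrite mulmxBr mulmxBl -scalemxAr -scalemxAl mulmxA -[_ *m b *m v]mulmxA.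
  rewrite -trmx_mul !mxE big_ord1 !mxE.
  set s := \sum_j b 0 j * v j 0.
  have [->|a0] := eqVneq a 0; first by rewrite invr0; lra.
  have -> : a * (- a^-1 * s) ^+ 2 = a^-1 * (s * s) by field.
  have -> : 2 * (- a^-1 * s) * s = - 2 * (a^-1 * (s * s)) by ring.
  lra.
move=> G' G'E.
suff: Z' = (block_mx (Num.sqrt a)%:M ((Num.sqrt a)^-1 *: b) 0 G')^T
           *m block_mx (Num.sqrt a)%:M ((Num.sqrt a)^-1 *: b) 0 G'.
  by move=> Z'E; exists (block_mx (Num.sqrt a)%:M ((Num.sqrt a)^-1 *: b) 0 G').
rewrite ZE tr_block_mx mulmx_block -G'E trmx0 !mulmx0 !mul0mx !addr0.
rewrite tr_scalar_mx -scalar_mxM -expr2 sqr_sqrtr //.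
have -> : ((Num.sqrt a)^-1 *: b)^T = (Num.sqrt a)^-1 *: b^T by rewrite linearZ.
rewrite mul_scalar_mx mul_mx_scalar -scalemxAl -scalemxAr !scalerA.
rewrite -invfM -expr2 sqr_sqrtr // addrC subrK.
have [a0|a0] := eqVneq a 0; first by rewrite b0 // !trmx0 !scaler0.
by rewrite ?mulVf ?divff ?scale1r // sqrtr_eq0 -ltNge lt_neqAle eq_sym a0.
Qed.

Lemma continuous_sum (T : topologicalType) (J : Type) (r : seq J) (F : J -> T -> R) :
  (forall j, continuous (F j)) -> continuous (fun x => \sum_(j <- r) F j x).
Proof. by move=> cF; apply: continuous_big => //; exact: add_continuous. Qed.

Definition sqnorm n (x : 'rV[R]_n) : R := \sum_i x 0 i ^+ 2.

Lemma sqnorm_ge0 n (x : 'rV[R]_n) : 0 <= sqnorm x.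
Proof. by apply: sumr_ge0 => i _; exact: sqr_ge0. Qed.

Lemma sqnorm_eq0 n (x : 'rV[R]_n) : sqnorm x = 0 -> x = 0.
Proof.
move/eqP; rewrite psumr_eq0 => [/allP x0|i _]; last exact: sqr_ge0.
apply/rowP => i; rewrite mxE; apply/eqP.
by have := x0 i (mem_index_enum i); rewrite sqrf_eq0.
Qed.

Lemma sqnormE n (x : 'rV[R]_n) : sqnorm x = (x *m x^T) 0 0.
Proof. by rewrite mxE; apply: eq_bigr => i _; rewrite mxE. Qed.

Lemma sqnormD n (x y : 'rV[R]_n) (a b : R) :
  sqnorm (a *: x + b *: y)
  = a ^+ 2 * sqnorm x + 2 * (a * b) * (y *m x^T) 0 0 + b ^+ 2 * sqnorm y.
Proof.
rewrite /sqnorm !mxE !mulr_sumr -!big_split /=; apply: eq_bigr => i _.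
by rewrite !mxE; ring.
Qed.

Lemma sphere_compact n : compact [set x : 'rV[R]_n | sqnorm x = 1].
Proof.
have /subclosed_compact: closed [set x : 'rV[R]_n | sqnorm x = 1].
  apply: (@preimage_closed _ _ (@sqnorm n) [set t | t = 1]).
    move=> x _; apply: continuous_sum => i {}x.
    by apply: (@continuousM _ _ (fun x : 'rV[R]_n => x 0 i) (fun x => x 0 i));
      exact: coord_continuous.
  exact: closed_eq.
apply.
  exact: (@rV_compact R n (fun=> `[-1, 1]%classic) (fun=> @segment_compact _ _ _)).
move=> x /= x1 i; rewrite in_itv /= -ler_norml -(@ler_pXn2r _ 2) ?nnegrE //.
rewrite real_normK ?num_real // expr1n -x1 /sqnorm (bigD1 i) //= lerDl.
by apply: sumr_ge0 => j _; exact: sqr_ge0.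
Qed.

(** The base {tr Z = 1} of the positive semidefinite cone is the image of a
    euclidean sphere under G |-> G^T G, which makes its compactness available. *)
Lemma mxtrace_gram s (G : 'M[R]_s) : \tr (G^T *m G) = sqnorm (mxvec G).
Proof.
rewrite /sqnorm (reindex _ (curry_mxvec_bij s s)) /=.
transitivity (\sum_i \sum_j G j i ^+ 2).
  by apply: eq_bigr => i _; rewrite mxE; apply: eq_bigr => j _; rewrite mxE.
rewrite exchange_big pair_big /=.
by apply: eq_bigr => -[i j] _; rewrite /= mxvecE.
Qed.

Lemma psd_gram_sq m n (G : 'M[R]_(m, n)) : psdmx (G^T *m G).
Proof.
split=> [|u]; first by rewrite trmx_mul trmxK.
rewrite mulmxA -trmx_mul -mulmxA mxE.
by apply: sumr_ge0 => i _; rewrite mxE -expr2 sqr_ge0.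
Qed.

Lemma psd_form_eq0 n (M : 'M[R]_n) (u : 'cV[R]_n) :
  psdmx M -> (u^T *m M *m u) 0 0 = 0 -> M *m u = 0.
Proof.
move=> /psd_gram[G ->].
rewrite mulmxA -trmx_mul -mulmxA -{2}[G *m u]trmxK -sqnormE => /sqnorm_eq0 Gu.
by rewrite -mulmxA -[G *m u]trmxK Gu trmx0 mulmx0.
Qed.

Lemma gram_rows m n (G : 'M[R]_(m, n)) :
  G^T *m G = \sum_i (row i G)^T *m row i G.
Proof.
apply/matrixP => j k; rewrite summxE !mxE; apply: eq_bigr => i _.
by rewrite !mxE big_ord1 !mxE.
Qed.

Lemma psdD n (A B : 'M[R]_n) (a b : R) :
  0 <= a -> 0 <= b -> psdmx A -> psdmx B -> psdmx (a *: A + b *: B).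
Proof.
move=> a0 b0 [As Ap] [Bs Bp]; split=> [|u].
  by rewrite linearD !linearZ /= As Bs.
rewrite mulmxDr mulmxDl -!scalemxAr -!scalemxAl mxE mxE [X in _ + X]mxE.
by rewrite addr_ge0 // mulr_ge0.
Qed.

Lemma gram_min s M (c : {linear 'M[R]_s -> 'rV[R]_M}) : (0 < s)%N ->
  exists2 G0 : 'M_s, \tr (G0^T *m G0) = 1 &
    forall G : 'M_s, \tr (G^T *m G) = 1 ->
      sqnorm (c (G0^T *m G0)) <= sqnorm (c (G^T *m G)).
Proof.
case: s c => // s c _.
pose f (x : 'rV[R]_(s.+1 * s.+1)) := sqnorm (c ((vec_mx x)^T *m vec_mx x)).
have [||x0 /set_mem /= x0S minf] := @compact_EVT_min _ R f _ _ (@sphere_compact (s.+1 * s.+1)).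
- exists (delta_mx 0 (mxvec_index 0 0)) => /=.
  rewrite /sqnorm (bigD1 (mxvec_index 0 0)) //= big1 => [|i /negPf i0].
    by rewrite mxE !eqxx expr1n addr0.
  by rewrite mxE i0 andbF expr0n.
- apply: continuous_subspaceT => x.
  have fE : f = fun x => \sum_k (\sum_i \sum_j
      (\sum_l x 0 (mxvec_index l i) * x 0 (mxvec_index l j)) * c (delta_mx i j) 0 k) ^+ 2.
    apply/funext => y; apply: eq_bigr => k _; congr (_ ^+ 2).
    rewrite [X in c X]matrix_sum_delta linear_sum summxE; apply: eq_bigr => i _.
    rewrite linear_sum summxE; apply: eq_bigr => j _.
    rewrite linearZ !mxE; congr (_ * _).
    by apply: eq_bigr => l _; rewrite !mxE.
  rewrite fE; apply: continuous_sum => k {}x.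
  apply: (@continuous_comp _ _ _ _ (fun t : R => t ^+ 2)); last exact: exprn_continuous.
  apply: continuous_sum => i {}x; apply: continuous_sum => j {}x.
  apply: (@continuousM _ _ (fun x : 'rV[R]_(s.+1 * s.+1) => \sum_l _));
    last exact: cst_continuous.
  apply: continuous_sum => l {}x.
  by apply: (@continuousM _ _ (fun x : 'rV[R]_(s.+1 * s.+1) => x 0 _)
               (fun x : 'rV[R]_(s.+1 * s.+1) => x 0 _)); exact: coord_continuous.
exists (vec_mx x0) => [|G G1]; first by rewrite mxtrace_gram vec_mxK.
rewrite -[G]mxvecK; apply: minf.
by apply/mem_set; rewrite /= -mxtrace_gram.
Qed.

(** A linear map that kills no nonzero positive semidefinite matrix sends the
    base {tr Z = 1} to a compact convex set missing 0.  The point c1 of that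
    set nearest to 0 makes a positive scalar product with every point of
    it: otherwise moving from c1 towards that point would decrease the norm. *)
Lemma psd_separation s M (c : {linear 'M[R]_s -> 'rV[R]_M}) :
  (forall G : 'M_s, c (G^T *m G) = 0 -> G = 0) ->
  exists y : 'cV_M, forall u : 'rV_s, u != 0 -> 0 < (c (u^T *m u) *m y) 0 0.
Proof.
move=> c0; have [s0|s_gt0] := posnP s.
  by exists 0 => u /eqP[]; apply/rowP => -[i si]; exfalso; move: si; rewrite s0.
have [G0 trG0 minG0] := gram_min c s_gt0.
exists (c (G0^T *m G0))^T => u u0.
have nu_gt0 : 0 < sqnorm u.
  by rewrite lt_neqAle sqnorm_ge0 andbT eq_sym; apply: contra_neq u0; exact: sqnorm_eq0.
have nG0_gt0 : 0 < sqnorm (c (G0^T *m G0)).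
  rewrite lt_neqAle sqnorm_ge0 andbT eq_sym; apply/eqP => /sqnorm_eq0/c0 G00.
  by move: trG0; rewrite G00 mulmx0 mxtrace0 => /eqP; rewrite eq_sym oner_eq0.
rewrite ltNge; apply/negP => y_le0.
set e := c (u^T *m u) in y_le0; set c1 := c (G0^T *m G0) in y_le0 nG0_gt0 minG0.
have min_seg t : 0 <= t <= 1 ->
    sqnorm c1 <= sqnorm ((1 - t) *: c1 + (t / sqnorm u) *: e).
  move=> /andP[t0 t1].
  have [G GE] : exists G : 'M_s,
      (1 - t) *: (G0^T *m G0) + (t / sqnorm u) *: (u^T *m u) = G^T *m G.
    apply: psd_gram; apply: psdD; rewrite ?subr_ge0 //; try exact: psd_gram_sq.
    by rewrite divr_ge0 // ltW.
  have -> : (1 - t) *: c1 + (t / sqnorm u) *: e = c (G^T *m G).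
    by rewrite -GE linearD !linearZ.
  apply: minG0; rewrite -GE linearD !linearZ /= trG0.
  by rewrite mxtrace_mulC /mxtrace big_ord1 -sqnormE mulr1 divfK ?subrK // gt_eqF.
set a := sqnorm c1 in nG0_gt0 min_seg.
set b := sqnorm e / sqnorm u ^+ 2.
have b_ge0 : 0 <= b by rewrite divr_ge0 ?sqnorm_ge0 // sqr_ge0.
(* With <c1, e> <= 0, minimality gives 2 a <= t (a + b) for all t in ]0, 1];
   this t violates it. *)
pose t := a / (a + b).
have ab : 0 < a + b by rewrite ltr_wpDr.
have t01 : 0 < t <= 1 by rewrite divr_gt0 //= ler_pdivrMr // mul1r lerDl.
have /andP[t_gt0 t_le1] := t01.
have := min_seg t; rewrite (ltW t_gt0) t_le1 => /(_ isT).
rewrite sqnormD -/a.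
set z := (e *m c1^T) 0 0 in y_le0 *.
have : 2 * ((1 - t) * (t / sqnorm u)) * z <= 0.
  by rewrite mulr_ge0_le0 // !mulr_ge0 ?subr_ge0 // ?invr_ge0 ltW.
have -> : (t / sqnorm u) ^+ 2 * sqnorm e = t * (t * b).
  by rewrite /b; field; rewrite gt_eqF.
have tb : t * (a + b) = a by rewrite /t divfK // gt_eqF.
have : 0 < t * a by rewrite mulr_gt0.
nra.
Qed.

End Separation.

(** * Finite-dimensional quotients *)

Section BasisModulo.
Variables (F : fieldType) (A : nzRingType) (rho : {rmorphism F -> A}) (V : lmodType A).

(** The scalars act on V through rho, since V carries only its module structure
    over the noncommutative ring A. *)
Definition subspace (J : set V) : Prop :=
  J 0 /\ forall a x y, J x -> J y -> J (rho a *: x + y).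

Definition lincomb (T : finType) (f : T -> V) (c : T -> F) : V :=
  \sum_i rho (c i) *: f i.

Lemma lincomb_linear (T : finType) (f : T -> V) a (c d : T -> F) :
  lincomb f (fun t => a * c t + d t) = rho a *: lincomb f c + lincomb f d.
Proof.
rewrite /lincomb scaler_sumr -big_split; apply: eq_bigr => i _.
by rewrite rmorphD rmorphM scalerDl scalerA.
Qed.

(** Linear combinations with a row of coefficients, so that the Gram matrix of
    a family can be handled by matrix algebra. *)
Definition comb n (f : 'I_n -> V) (c : 'rV[F]_n) : V := lincomb f (c 0).

Lemma comb_linear n (f : 'I_n -> V) a (c d : 'rV[F]_n) :
  comb f (a *: c + d) = rho a *: comb f c + comb f d.
Proof.
by rewrite -lincomb_linear; congr lincomb; apply/funext => i; rewrite !mxE.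
Qed.

Lemma combB n (f : 'I_n -> V) (c d : 'rV[F]_n) : comb f (c - d) = comb f c - comb f d.
Proof.
have := comb_linear f (- 1) d c.
by rewrite !scaleN1r rmorphN rmorph1 scaleN1r addrC => ->; rewrite addrC.
Qed.

Lemma comb0 n (f : 'I_n -> V) : comb f 0 = 0.
Proof. by rewrite -[X in comb f X](subrr 0) combB subrr. Qed.

Lemma comb_comb m n (f : 'I_n -> V) (B : 'M[F]_(m, n)) (c : 'rV[F]_m) :
  comb (fun j => comb f (row j B)) c = comb f (c *m B).
Proof.
rewrite /comb /lincomb; under eq_bigr do rewrite scaler_sumr.
rewrite exchange_big; apply: eq_bigr => k _.
rewrite mxE rmorph_sum scaler_suml; apply: eq_bigr => j _.
by rewrite !mxE rmorphM scalerA.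
Qed.

Section Subspace.
Variables (J : set V) (subJ : subspace J).

Lemma subspace_lin a b x y : J x -> J y -> J (rho a *: x + rho b *: y).
Proof.
move: subJ => [J0 JD] Jx Jy; apply: (JD) => //.
by rewrite -[_ *: y]addr0; apply: (JD).
Qed.

Lemma subspaceD x y : J x -> J y -> J (x + y).
Proof. by move=> Jx Jy; have := subspace_lin 1 1 Jx Jy; rewrite rmorph1 !scale1r. Qed.

Lemma subspaceB x y : J x -> J y -> J (x - y).
Proof.
move=> Jx Jy; have := subspace_lin 1 (- 1) Jx Jy.
by rewrite rmorphN rmorph1 scaleN1r scale1r.
Qed.

Lemma subspaceZ a x : J x -> J (rho a *: x).
Proof.
by move=> Jx; have := subspace_lin a 0 Jx Jx; rewrite rmorph0 scale0r addr0.
Qed.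

Lemma subspace_sum (T : Type) (r : seq T) (P : pred T) (x : T -> V) :
  (forall i, P i -> J (x i)) -> J (\sum_(i <- r | P i) x i).
Proof.
move=> Jx; apply: big_ind => //; [by case: subJ | exact: subspaceD].
Qed.

Definition free_mod n (f : 'I_n -> V) := forall c, J (comb f c) -> c = 0.

(** The quotient of a finitely spanned space by J has a basis drawn from the
    spanning family: a maximal subfamily that is independent modulo J. *)
Lemma basis_mod (T : finType) (e : T -> V) :
  exists M (f : 'I_M -> V),
    [/\ forall i, exists j, f i = e j, free_mod f &
        forall c, exists d, J (lincomb e c - comb f d)].
Proof.
pose indep (S : {set T}) := forall c : T -> F,
  J (\sum_(i in S) rho (c i) *: e i) -> forall i, i \in S -> c i = 0.
have [|S /maxsetP[/asboolP indS maxS]] := @ex_maxset _ (fun S => `[< indep S >]).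
  by exists finset.set0; apply/asboolP => c _ i; rewrite inE.
have spanS j : exists d : T -> F, J (e j - \sum_(i in S) rho (d i) *: e i).
  have [jS|jS] := boolP (j \in S).
    exists (fun i => (i == j)%:R); rewrite (bigD1 j) //= eqxx rmorph1 scale1r.
    rewrite big1 ?addr0 ?subrr; first by case: subJ.
    by move=> i /andP[_ /negPf->]; rewrite rmorph0 scale0r.
  have : ~ indep (j |: S).
    move=> ind'; move: jS.
    rewrite -(maxS (j |: S)) ?finset.setU11 ?finset.subsetUr //.
    by apply/asboolP.
  move=> /existsNP[c] /not_implyP[]; rewrite big_setU1 //= => Jc /existsNP[i].
  move=> /not_implyP[iS /eqP ci].
  have cj : c j != 0.
    apply: contraNneq ci => cj.
    move: Jc; rewrite cj rmorph0 scale0r add0r => /indS c0.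
    by move: iS; rewrite !inE => /predU1P[->|/c0 ->]; rewrite ?cj.
  exists (fun i => - (c j)^-1 * c i).
  have := subspaceZ (c j)^-1 Jc.
  rewrite scalerDr scalerA -rmorphM mulVf // rmorph1 scale1r scaler_sumr.
  congr (J (_ + _)); rewrite -sumrN; apply: eq_bigr => k _.
  by rewrite scalerA -rmorphM mulNr rmorphN scaleNr opprK.
exists #|S|, (fun k => e (enum_val k)); split.
- by move=> k; exists (enum_val k).
- move=> c Jc; apply/rowP => k; rewrite mxE.
  pose c' i := c 0 (enum_rank_in (enum_valP k) i).
  have := indS c' _ (enum_val k) (enum_valP k).
  rewrite /c' enum_valK_in; apply.
  rewrite big_enum_val; congr J : Jc; rewrite /comb /lincomb; apply: eq_bigr => i _.
  by rewrite enum_valK_in.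
- move=> c; have [d dP] := choice spanS.
  exists (\row_k \sum_j c j * d j (enum_val k)).
  rewrite /comb /lincomb.
  have -> : \sum_(k < #|S|) rho ((\row_k0 \sum_j c j * d j (enum_val k0)) 0 k) *:
        e (enum_val k) = \sum_j rho (c j) *: \sum_(i in S) rho (d j i) *: e i.
    under eq_bigr do rewrite mxE rmorph_sum scaler_suml.
    rewrite exchange_big; apply: eq_bigr => j _.
    rewrite [in RHS]big_enum_val scaler_sumr; apply: eq_bigr => k _.
    by rewrite rmorphM scalerA.
  rewrite -sumrB; apply: subspace_sum => j _.
  by rewrite -scalerBr; apply: subspaceZ.
Qed.

End Subspace.
End BasisModulo.

(** * The involution on noncommutative polynomials *)

Section Star.
Variables (R : realType) (g : nat).
Local Notation ncp := {ncpoly R[g]}.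
Implicit Types (a b : ncp) (u w : word g).

Lemma letter_starK : involutive (@letter_star g).
Proof. by case. Qed.

Lemma word_starK : involutive (@word_star g).
Proof.
by case=> s; rewrite /word_star /= map_rev revK -map_comp map_id_in // => x _;
  exact: letter_starK.
Qed.

Lemma word_starM u w : word_star (mmul u w) = mmul (word_star w) (word_star u).
Proof. by apply/eqP; rewrite fmP fmM /= fmM map_cat rev_cat. Qed.

Lemma word_star1 : word_star (mone : word g) = mone.
Proof. by apply/eqP; rewrite fmP /= !fm1. Qed.

Lemma mcoeff_ncstar a w : (ncstar a)@_w = a@_(word_star w).
Proof.
rewrite /ncstar raddf_sum /= -[in RHS](word_starK w).
under eq_bigr do rewrite mcoeffU.
have [aw|aw] := boolP (word_star w \in msupp a).
  rewrite (big_fsetD1 _ aw) /= word_starK eqxx big_seq big1 ?addr0 ?word_starK //.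
  move=> u; rewrite !inE => /andP[uw _].
  by rewrite (can2_eq word_starK word_starK) (negPf uw).
rewrite word_starK (mcoeff_outdom aw) big_seq big1 // => u ua.
by case: eqP => // uw; move: aw; rewrite -uw word_starK ua.
Qed.

Lemma ncstar_is_zmod_morphism : zmod_morphism (@ncstar R g).
Proof.
move=> a b; apply/malgP => w.
by rewrite [LHS]mcoeff_ncstar [RHS]mcoeffB 2!mcoeff_ncstar mcoeffB.
Qed.

HB.instance Definition _ :=
  GRing.isZmodMorphism.Build ncp ncp (@ncstar R g) ncstar_is_zmod_morphism.

Lemma ncstarK : involutive (@ncstar R g).
Proof. by move=> a; apply/malgP => w; rewrite !mcoeff_ncstar word_starK. Qed.

Lemma ncstarU (c : R) w : ncstar << c *g w >> = << c *g word_star w >>.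
Proof.
apply/malgP => u; rewrite mcoeff_ncstar !mcoeffU.
by rewrite (can2_eq word_starK word_starK).
Qed.

Lemma malgUM (c d : R) u w : << c *g u >> * << d *g w >> = << c * d *g mmul u w >> :> ncp.
Proof. by rewrite malgM_def fgmulUU. Qed.

Lemma ncstarM a b : ncstar (a * b) = ncstar b * ncstar a.
Proof.
rewrite [a]monalgE [b]monalgE mulr_suml !raddf_sum mulr_sumr.
apply: eq_bigr => u _; rewrite mulr_sumr !raddf_sum mulr_suml.
by apply: eq_bigr => w _; rewrite /= malgUM !ncstarU malgUM word_starM mulrC.
Qed.

Lemma malgC_comm (c : R) a : a * c%:MP = c%:MP * a.
Proof.
rewrite [a]monalgE mulr_suml mulr_sumr; apply: eq_bigr => u _.
by rewrite !malgUM mulrC mulm1 mul1m.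
Qed.

Lemma ncstarC (c : R) : ncstar c%:MP = c%:MP :> ncp.
Proof. by rewrite ncstarU word_star1. Qed.

Lemma ncstarZ (c : R) a : ncstar (c%:MP * a) = c%:MP * ncstar a.
Proof. by rewrite ncstarM ncstarC malgC_comm. Qed.

Lemma mxstar1 n : mxstar 1%:M = 1%:M :> 'M[ncp]_n.
Proof.
apply/matrixP => i j; rewrite !mxE eq_sym raddfMn /=.
by rewrite -[ncstar 1]/(ncstar 1%:MP) ncstarC.
Qed.

Section Mx.
Variables (n m p : nat).

Lemma mxstar_is_zmod_morphism : zmod_morphism (@mxstar R g n m).
Proof. by move=> A B; apply/matrixP => i j; rewrite !mxE raddfB. Qed.

HB.instance Definition _ :=
  GRing.isZmodMorphism.Build _ _ (@mxstar R g n m) mxstar_is_zmod_morphism.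

Lemma mxstarE (A : 'M[ncp]_(n, m)) i j : mxstar A i j = ncstar (A j i).
Proof. by rewrite !mxE. Qed.

Lemma mxstarZ (c : R) (A : 'M[ncp]_(n, m)) : mxstar (c%:MP *: A) = c%:MP *: mxstar A.
Proof. by apply/matrixP => i j; rewrite !mxE ncstarZ. Qed.

Lemma mxstarK (A : 'M[ncp]_(n, m)) : mxstar (mxstar A) = A.
Proof. by apply/matrixP => i j; rewrite !mxE ncstarK. Qed.

Lemma mxstarM (A : 'M[ncp]_(n, m)) (B : 'M[ncp]_(m, p)) :
  mxstar (A *m B) = mxstar B *m mxstar A.
Proof.
apply/matrixP => i j; rewrite !mxE raddf_sum; apply: eq_bigr => k _.
by rewrite !mxE /= ncstarM.
Qed.

Lemma mulmx_malgC (c : R) (A : 'M[ncp]_(n, m)) (B : 'M[ncp]_(m, p)) :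
  A *m (c%:MP *: B) = c%:MP *: (A *m B).
Proof.
apply/matrixP => i j; rewrite !mxE mulr_sumr; apply: eq_bigr => k _.
by rewrite !mxE !mulrA malgC_comm.
Qed.

End Mx.

Lemma scale_malgC n m a (c : R) (A : 'M[ncp]_(n, m)) :
  a *: (c%:MP *: A) = c%:MP *: (a *: A).
Proof. by rewrite !scalerA malgC_comm. Qed.

Lemma mulmx_star_scale n m p a (A : 'M[ncp]_(n, m)) (B : 'M[ncp]_(n, p)) :
  mxstar (a *: A) *m B = mxstar A *m (ncstar a *: B).
Proof.
apply/matrixP => i j; rewrite [LHS]mxE [RHS]mxE; apply: eq_bigr => k _.
by rewrite !mxstarE [(a *: A) k i]mxE [(ncstar a *: B) k j]mxE ncstarM -mulrA.
Qed.

Lemma row_mulmx n m p (A : 'M[ncp]_(n, m)) (B : 'M[ncp]_(m, p)) i :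
  row i (A *m B) = \sum_j A i j *: row j B.
Proof.
by rewrite row_mul mulmx_sum_row; apply: eq_bigr => j _; rewrite [row i A 0 j]mxE.
Qed.

Lemma mulmx_col_row n m p (A : 'M[ncp]_(n, m)) (B : 'M[ncp]_(m, p)) :
  A *m B = \sum_i col i A *m row i B.
Proof.
apply/matrixP => i j; rewrite [LHS]mxE [RHS]summxE; apply: eq_bigr => k _.
by rewrite [RHS]mxE big_ord1 [col k A i 0]mxE [row k B 0 j]mxE.
Qed.

End Star.

(** * Evaluation at tuples of matrices *)

Section Eval.
Variables (R : realType) (g : nat) (n : nat) (X : 'I_g -> 'M[R]_n).
Local Notation ncp := {ncpoly R[g]}.
Implicit Types (a b : ncp) (u w : word g).

Lemma word_evalM u w : word_eval X (mmul u w) = word_eval X u *m word_eval X w.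
Proof. by rewrite /word_eval fmM big_cat. Qed.

Lemma letter_eval_star x : letter_eval X (letter_star x) = (letter_eval X x)^T.
Proof. by case: x => i //=; rewrite trmxK. Qed.

Lemma word_eval_star w : word_eval X (word_star w) = (word_eval X w)^T.
Proof.
case: w => s; rewrite /word_eval /=; elim: s => [|x s IHs] /=.
  by rewrite !big_nil trmx1.
by rewrite rev_cons -cats1 big_cat big_seq1 /= IHs big_cons trmx_mul letter_eval_star.
Qed.

(** Evaluation of a single polynomial; the Kronecker sum evaluating a matrix
    polynomial has these matrices as its blocks ([mxevalE]). *)
Definition peval a : 'M[R]_n := \sum_(w <- msupp a) a@_w *: word_eval X w.

Lemma pevalEw (d : {fset word g}) a : (msupp a `<=` d)%fset ->
  peval a = \sum_(w <- d) a@_w *: word_eval X w.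
Proof.
move=> le_ad; rewrite /peval (big_fset_incl _ le_ad) // => w _ aw.
by rewrite (mcoeff_outdom aw) scale0r.
Qed.

Lemma peval_is_zmod_morphism : zmod_morphism peval.
Proof.
move=> a b; pose d := (msupp a `|` msupp b)%fset.
rewrite !(@pevalEw d) ?fsubsetUl ?fsubsetUr ?msuppB_le //.
by rewrite -sumrB; apply: eq_bigr => w _; rewrite mcoeffB scalerBl.
Qed.

HB.instance Definition _ :=
  GRing.isZmodMorphism.Build ncp 'M[R]_n peval peval_is_zmod_morphism.

Lemma pevalU (c : R) w : peval << c *g w >> = c *: word_eval X w.
Proof. by rewrite (pevalEw msuppU_le) big_seq_fset1 mcoeffUU. Qed.

Lemma pevalM a b : peval (a * b) = peval a *m peval b.
Proof.
rewrite {1}[a]monalgE mulr_suml raddf_sum [peval a]/peval mulmx_suml.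
apply: eq_bigr => u _; rewrite {1}[b]monalgE mulr_sumr raddf_sum [peval b]/peval.
rewrite mulmx_sumr; apply: eq_bigr => w _; rewrite /= malgUM pevalU word_evalM.
by rewrite -scalemxAl -scalemxAr scalerA.
Qed.

Lemma peval_star a : peval (ncstar a) = (peval a)^T.
Proof.
rewrite {1}[a]monalgE (raddf_sum (@ncstar R g)) (raddf_sum peval) [RHS]raddf_sum.
apply: eq_bigr => u _ /=.
by rewrite ncstarU pevalU word_eval_star linearZ.
Qed.

Lemma mxevalE p q (P : 'M[ncp]_(p, q)) i k j h :
  mxeval X P (mxtens_index (i, k)) (mxtens_index (j, h)) = peval (P i j) k h.
Proof.
have subP : (msupp (P i j) `<=` mxsupp P)%fset.
  rewrite /mxsupp (bigD1 i) //= (bigD1 j) //= -fsetUA; exact: fsubsetUl.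
rewrite (pevalEw subP) /mxeval !summxE; apply: eq_bigr => w _.
by rewrite tensmxE !mxE.
Qed.

(** A vector of length p * n as p vectors of length n, in the order of the
    Kronecker product. *)
Definition block p (v : 'cV[R]_(p * n)) (i : 'I_p) : 'cV[R]_n :=
  \col_k v (mxtens_index (i, k)) 0.

Lemma block_inj p (v w : 'cV[R]_(p * n)) : block v =1 block w -> v = w.
Proof.
move=> vw; apply/colP => i.
have := congr1 (fun f : 'cV__ => f (mxtens_unindex i).2 0) (vw (mxtens_unindex i).1).
by rewrite !mxE -surjective_pairing mxtens_unindexK.
Qed.

Lemma big_mxtens p (F : 'I_(p * n) -> R) :
  \sum_i F i = \sum_(j < p) \sum_(k < n) F (mxtens_index (j, k)).
Proof.
rewrite pair_big /= (reindex (@mxtens_index p n)) /=; last first.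
  by exists (@mxtens_unindex p n) => i _; rewrite ?mxtens_indexK ?mxtens_unindexK.
by apply: eq_bigr => -[].
Qed.

Lemma block_mxeval p q (P : 'M[ncp]_(p, q)) (v : 'cV[R]_(q * n)) i :
  block (mxeval X P *m v) i = \sum_j peval (P i j) *m block v j.
Proof.
apply/colP => k; rewrite !mxE summxE big_mxtens; apply: eq_bigr => j _.
by rewrite mxE; apply: eq_bigr => h _; rewrite mxevalE mxE.
Qed.

Lemma mxtens_eqP p q (A B : 'M[R]_(p * n, q * n)) :
  (forall i k j h, A (mxtens_index (i, k)) (mxtens_index (j, h))
                   = B (mxtens_index (i, k)) (mxtens_index (j, h))) -> A = B.
Proof.
move=> AB; apply/matrixP => x y; rewrite -(mxtens_unindexK x) -(mxtens_unindexK y).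
by case: (mxtens_unindex x) (mxtens_unindex y) => i k [j h].
Qed.

Lemma mxeval_is_zmod_morphism p q : zmod_morphism (@mxeval R g n X p q).
Proof.
move=> A B; apply: mxtens_eqP => i k j h.
by rewrite mxevalE !mxE !mxevalE raddfB !mxE.
Qed.

HB.instance Definition _ p q := GRing.isZmodMorphism.Build _ _
  (@mxeval R g n X p q) (@mxeval_is_zmod_morphism p q).

Lemma mxevalM p q r (A : 'M[ncp]_(p, q)) (B : 'M[ncp]_(q, r)) :
  mxeval X (A *m B) = mxeval X A *m mxeval X B.
Proof.
apply: mxtens_eqP => i k j h; rewrite mxevalE !mxE raddf_sum summxE big_mxtens.
apply: eq_bigr => s _; rewrite /= pevalM mxE; apply: eq_bigr => t _.
by rewrite !mxevalE.
Qed.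

Lemma mxeval_star p q (A : 'M[ncp]_(p, q)) :
  mxeval X (mxstar A) = (mxeval X A)^T.
Proof.
apply: mxtens_eqP => i k j h.
by rewrite mxevalE [RHS]mxE mxevalE !mxE peval_star mxE.
Qed.

Lemma mxeval_rows_eq0 p q (A : 'M[ncp]_(p, q)) (v : 'cV[R]_(q * n)) :
  mxeval X A *m v = 0 <-> forall i, mxeval X (row i A) *m v = 0.
Proof.
have rowE i : block (mxeval X (row i A) *m v) 0 = block (mxeval X A *m v) i.
  by rewrite !block_mxeval; apply: eq_bigr => j _; rewrite mxE.
have block0 r i : block (0 : 'cV[R]_(r * n)) i = 0 by apply/colP => k; rewrite !mxE.
split=> [Av i|Av]; first by apply: block_inj => j; rewrite (ord1 j) rowE Av !block0.
by apply: block_inj => i; rewrite -rowE Av !block0.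
Qed.

End Eval.

(** * Polynomials vanishing at a point of positivity *)

Section Kernel.
Variables (R : realType) (g nu l n : nat) (L : 'M[{ncpoly R[g]}]_nu).
Variables (X : 'I_g -> 'M[R]_n) (v : 'cV[R]_(l * n)).
Local Notation ncp := {ncpoly R[g]}.

Definition eval_kernel : set 'rV[ncp]_l := [set q | mxeval X q *m v = 0].

Lemma eval_kernel_left_module : left_module eval_kernel.
Proof.
split=> [|a p q]; rewrite !in_setE /eval_kernel /=.
  by rewrite raddf0 mul0mx.
move=> p0 q0; rewrite raddfD /= mulmxDl q0 addr0 -mul_scalar_mx mxevalM.
by rewrite -mulmxA p0 mulmx0.
Qed.

(** The form <s(X) v, v> is zero for s in the symmetric span, while on a
    weighted sum of squares it is a sum of nonnegative terms, each of which must
    therefore vanish.  For the terms with L the vanishing of a positive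
    semidefinite form at a vector means that the vector is in the kernel. *)
Lemma eval_kernel_Lreal : psdmx (mxeval X L) -> Lreal L eval_kernel.
Proof.
move=> psdL; split=> [|s t p q]; first exact: eval_kernel_left_module.
case=> A Aker [_ [C Cker <-]] sumE.
have quadE k (P : 'M[ncp]_(k, l)) (M : 'M[ncp]_k) :
    v^T *m mxeval X (mxstar P *m M *m P) *m v
    = (mxeval X P *m v)^T *m mxeval X M *m (mxeval X P *m v).
  by rewrite !mxevalM mxeval_star trmx_mul !mulmxA.
have ker0 (P : 'M[ncp]_l) : rows_in l eval_kernel P -> mxeval X P *m v = 0.
  by move=> Pker; apply/mxeval_rows_eq0.
have: (v^T *m mxeval X (\sum_i mxstar (p i) *m p i
        + \sum_j mxstar (q j) *m L *m q j) *m v) 0 0 = 0.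
  rewrite -sumE raddfD /= mulmxDr mulmxDl -mulmxA ker0 // mulmx0 add0r.
  by rewrite mxeval_star -trmx_mul ker0 // trmx0 mul0mx mxE.
rewrite raddfD !raddf_sum /= mulmxDr !mulmx_sumr mulmxDl !mulmx_suml mxE !summxE.
have pE i : (v^T *m mxeval X (mxstar (p i) *m p i) *m v) 0 0
    = sqnorm (mxeval X (p i) *m v)^T.
  by rewrite sqnormE trmxK mxevalM mxeval_star trmx_mul !mulmxA.
have p_ge0 i : 0 <= (v^T *m mxeval X (mxstar (p i) *m p i) *m v) 0 0.
  by rewrite pE; exact: sqnorm_ge0.
have q_ge0 j : 0 <= (v^T *m mxeval X (mxstar (q j) *m L *m q j) *m v) 0 0.
  by rewrite quadE; apply: psdL.2.
move=> /eqP; rewrite paddr_eq0 ?sumr_ge0 // => /andP[].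
rewrite !psumr_eq0 // => /allP p0 /allP q0; split=> [i|j].
  have /eqP := p0 i (mem_index_enum i).
  by rewrite pE => /sqnorm_eq0/(congr1 trmx); rewrite trmxK trmx0.
have /eqP := q0 j (mem_index_enum j); rewrite quadE => /(psd_form_eq0 psdL).
by rewrite mulmxA -mxevalM; move/mxeval_rows_eq0.
Qed.

End Kernel.

(** * Degree *)

Section Degree.
Variables (R : realType) (g : nat).
Local Notation ncp := {ncpoly R[g]}.
Local Notation rho := (@monalg.mkmalgU (word g) R mone).

Definition ncdeg (k : nat) (a : ncp) : Prop :=
  forall w, w \in msupp a -> (fdeg w <= k)%N.

Definition mxdeg (k : nat) p q (P : 'M[ncp]_(p, q)) : Prop :=
  forall i j, ncdeg k (P i j).

Lemma ncdegP k a : ncdeg k a <-> forall w, (k < fdeg w)%N -> a@_w = 0.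
Proof.
split=> [ak w kw|ak w].
  by apply: mcoeff_outdom; apply: contraTN kw => /ak; rewrite leqNgt.
by rewrite -mcoeff_neq0 leqNgt; apply: contra_neqN => /ak.
Qed.

Lemma ncdeg_le k k' a : (k <= k')%N -> ncdeg k a -> ncdeg k' a.
Proof. by move=> kk' ak w /ak wk; exact: leq_trans kk'. Qed.

Lemma ncdegD k a b : ncdeg k a -> ncdeg k b -> ncdeg k (a + b).
Proof.
by move=> /ncdegP ak /ncdegP bk; apply/ncdegP => w kw; rewrite mcoeffD ak ?bk ?addr0.
Qed.

Lemma ncdeg0 k : ncdeg k 0.
Proof. by apply/ncdegP => w _; rewrite mcoeff0. Qed.

Lemma ncdeg_sum k (T : Type) (r : seq T) (P : pred T) (F : T -> ncp) :
  (forall i, P i -> ncdeg k (F i)) -> ncdeg k (\sum_(i <- r | P i) F i).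
Proof. by move=> Fk; apply: big_ind => //; [exact: ncdeg0 | exact: ncdegD]. Qed.

Lemma ncdegM k h a b : ncdeg k a -> ncdeg h b -> ncdeg (k + h) (a * b).
Proof.
move=> ak bh w /(fsubsetP (msuppM_incl a b)) /imfset2P[u /= ua [w' wb ->]].
by rewrite fdegM leq_add ?ak ?bh.
Qed.

Lemma ncdegU k c w : (fdeg w <= k)%N -> ncdeg k << c *g w >>.
Proof. by move=> wk u /(fsubsetP msuppU_le); rewrite inE => /eqP->. Qed.

Lemma ncdeg_star k a : ncdeg k a -> ncdeg k (ncstar a).
Proof.
move=> /ncdegP ak; apply/ncdegP => w kw; rewrite mcoeff_ncstar ak //.
by rewrite /fdeg /= size_rev size_map.
Qed.

Lemma ncdeg_ex a : exists k, ncdeg k a.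
Proof.
exists (\max_(w <- msupp a) fdeg w)%N => w wa.
by rewrite (big_fsetD1 _ wa) leq_maxl.
Qed.

Section Mx.
Variables p q r : nat.

Lemma mxdeg_le k k' (P : 'M[ncp]_(p, q)) : (k <= k')%N -> mxdeg k P -> mxdeg k' P.
Proof. by move=> kk' Pk i j; exact: ncdeg_le (Pk i j). Qed.

Lemma mxdegD k (P Q : 'M[ncp]_(p, q)) : mxdeg k P -> mxdeg k Q -> mxdeg k (P + Q).
Proof. by move=> Pk Qk i j; rewrite mxE; apply: ncdegD. Qed.

Lemma mxdeg_sum k (T : Type) (s : seq T) (F : T -> 'M[ncp]_(p, q)) :
  (forall i, mxdeg k (F i)) -> mxdeg k (\sum_(i <- s) F i).
Proof. by move=> Fk i j; rewrite summxE; apply: ncdeg_sum => t _; exact: Fk. Qed.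

Lemma mxdegM k h (P : 'M[ncp]_(p, q)) (Q : 'M[ncp]_(q, r)) :
  mxdeg k P -> mxdeg h Q -> mxdeg (k + h) (P *m Q).
Proof. by move=> Pk Qh i j; rewrite mxE; apply: ncdeg_sum => t _; exact: ncdegM. Qed.

Lemma mxdegZ k h a (P : 'M[ncp]_(p, q)) : ncdeg k a -> mxdeg h P -> mxdeg (k + h) (a *: P).
Proof. by move=> ak Ph i j; rewrite mxE; apply: ncdegM. Qed.

Lemma mxdegC k c (P : 'M[ncp]_(p, q)) : mxdeg k P -> mxdeg k (c%:MP *: P).
Proof.
by move=> Pk; apply: (@mxdegZ 0) => //; apply: ncdegU; rewrite fdeg1.
Qed.

Lemma mxdegB k (P Q : 'M[ncp]_(p, q)) : mxdeg k P -> mxdeg k Q -> mxdeg k (P - Q).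
Proof.
move=> Pk Qk; apply: mxdegD => // i j; rewrite mxE => w.
by rewrite msuppN; apply: Qk.
Qed.

Lemma mxdeg_star k (P : 'M[ncp]_(p, q)) : mxdeg k P -> mxdeg k (mxstar P).
Proof. by move=> Pk i j; rewrite !mxE; apply: ncdeg_star. Qed.

Lemma mxdeg_ex (P : 'M[ncp]_(p, q)) : exists k, mxdeg k P.
Proof.
have [k kP] := choice (fun ij : 'I_p * 'I_q => ncdeg_ex (P ij.1 ij.2)).
exists (\max_ij k ij)%N => i j; apply: ncdeg_le (kP (i, j)).
exact: leq_bigmax.
Qed.

Lemma mxdeg_comb k n (f : 'I_n -> 'M[ncp]_(p, q)) c :
  (forall i, mxdeg k (f i)) -> mxdeg k (comb rho f c).
Proof. by move=> fk; apply: mxdeg_sum => i; apply: mxdegC. Qed.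

(** The matrix units times words of length at most k: a finite spanning family
    of the matrices of degree at most k. *)
Definition monomx (k : nat) (t : 'I_p * 'I_q * {bseq k of letter g}) :
    'M[ncp]_(p, q) :=
  << FMonom t.2 >> *: delta_mx t.1.1 t.1.2.

Definition monomx_coef (k : nat) (P : 'M[ncp]_(p, q))
    (t : 'I_p * 'I_q * {bseq k of letter g}) : R :=
  (P t.1.1 t.1.2)@_(FMonom t.2).

Lemma mxdeg_monomx k t : mxdeg k (@monomx k t).
Proof.
move=> i j; rewrite !mxE; case: andP => _; last by rewrite mulr0; exact: ncdeg0.
by rewrite mulr1; apply: ncdegU; rewrite /fdeg /= size_bseq.
Qed.

Lemma lincomb_monomx k (P : 'M[ncp]_(p, q)) :
  mxdeg k P -> lincomb rho (@monomx k) (monomx_coef P) = P.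
Proof.
move=> Pk; apply/matrixP => i j; rewrite /lincomb summxE.
under eq_bigr => t _.
  rewrite /monomx !mxE mulrA malgUM mulr1 mul1m.
  over.
transitivity (\sum_(t : {bseq k of letter g}) << (P i j)@_(FMonom t) *g FMonom t >> : ncp).
  rewrite -(pair_big predT predT (fun ij (t : {bseq k of letter g}) =>
    << monomx_coef P (ij, t) *g FMonom t >> * ((i == ij.1) && (j == ij.2))%:R : ncp)) /=.
  rewrite (bigD1 (i, j)) //= [X in _ + X]big1 ?addr0.
    by apply: eq_bigr => t _; rewrite !eqxx mulr1.
  move=> [i' j'] /negPf ij; apply: big1 => t _.
  by rewrite -[_ && _]/((i, j) == (i', j')) eq_sym ij mulr0.
apply/malgP => w; rewrite raddf_sum /=.
under eq_bigr do rewrite mcoeffU.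
have [wk|kw] := leqP (fdeg w) k.
  rewrite (bigD1 (@Bseq k (letter g) w wk)) //= fmK eqxx big1 ?addr0 // => t tw.
  by case: eqP => // wE; move: tw; rewrite -val_eqE /= -wE eqxx.
rewrite big1 ?((ncdegP _ _).1 (Pk i j)) // => t _; case: eqP => // wE.
by move: kw; rewrite -wE /fdeg /= ltnNge size_bseq.
Qed.

End Mx.
End Degree.

(** * Left modules and symmetric spans *)

Section LeftModule.
Variables (R : realType) (g l : nat) (J : set 'rV[{ncpoly R[g]}]_l).
Hypothesis modJ : left_module J.
Local Notation ncp := {ncpoly R[g]}.
Local Notation rho := (@monalg.mkmalgU (word g) R mone).

Lemma left_module0 : J 0.
Proof. by have [/set_mem] := modJ. Qed.

Lemma left_moduleDZ a x y : J x -> J y -> J (a *: x + y).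
Proof.
by move=> Jx Jy; have [_ /(_ a x y)] := modJ; rewrite !in_setE; apply.
Qed.

Lemma left_moduleZ a x : J x -> J (a *: x).
Proof.
move=> Jx; rewrite -[_ *: _]addr0.
by apply: left_moduleDZ => //; exact: left_module0.
Qed.

Lemma left_module_sum (T : Type) (r : seq T) (c : T -> ncp) (x : T -> 'rV_l) :
  (forall i, J (x i)) -> J (\sum_(i <- r) c i *: x i).
Proof.
by move=> Jx; elim/big_rec: _ => [|i y _ Jy]; [exact: left_module0 | exact: left_moduleDZ].
Qed.

Lemma subspace_left_module : subspace rho J.
Proof. by split=> [|c x y]; [exact: left_module0 | exact: left_moduleDZ]. Qed.

Lemma subspace_rows_in a : subspace rho (rows_in a J).
Proof.
split=> [|c x y Jx Jy] i; first by rewrite row0; exact: left_module0.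
by rewrite linearD linearZ; apply: left_moduleDZ; [exact: Jx | exact: Jy].
Qed.

Lemma rows_in_mulmx a b (P : 'M[ncp]_(a, b)) (A : 'M[ncp]_(b, l)) :
  rows_in b J A -> rows_in a J (P *m A).
Proof. by move=> JA i; rewrite row_mul mulmx_sum_row; exact: left_module_sum. Qed.

Lemma rows_in_row (q : 'rV[ncp]_l) : rows_in 1 J q <-> J q.
Proof.
have rq : row 0 q = q by apply/rowP => j; rewrite mxE.
by split=> [/(_ 0)|Jq i]; rewrite ?(ord1 i) rq.
Qed.

Lemma subspace_sym_span : subspace rho (sym_span J).
Proof.
have [R0 RD] := subspace_rows_in l.
split=> [|c _ _ [A JA [_ [B JB <-] <-]] [A' JA' [_ [B' JB' <-] <-]]].
  by exists 0 => //; exists 0; rewrite ?addr0 //; exists 0; rewrite // raddf0.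
exists (c%:MP *: A + A'); first exact: RD.
exists (mxstar (c%:MP *: B + B')); first by exists (c%:MP *: B + B') => //; exact: RD.
by rewrite raddfD /= mxstarZ scalerDr addrACA.
Qed.

Lemma sym_span_rows (A : 'M[ncp]_l) : rows_in l J A -> sym_span J A.
Proof.
have [R0 _] := subspace_rows_in l.
by move=> JA; exists A => //; exists 0; rewrite ?addr0 //; exists 0; rewrite // raddf0.
Qed.

Lemma sym_span_star (A : 'M[ncp]_l) : sym_span J A -> sym_span J (mxstar A).
Proof.
move=> [B JB [_ [C JC <-] <-]]; exists C => //; exists (mxstar B); first by exists B.
by rewrite raddfD /= mxstarK addrC.
Qed.

(** Modulo the symmetric span, P^* M P depends only on the class of M P modulo J.
    This is what lets squares be parametrized by a finite-dimensional quotient. *)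
Lemma sym_span_square nu (M : 'M[ncp]_nu) (P Q : 'M[ncp]_(nu, l)) :
  mxstar M = M -> rows_in nu J (M *m (P - Q)) ->
  sym_span J (mxstar P *m M *m P - mxstar Q *m M *m Q).
Proof.
move=> Msym JPQ.
have -> : mxstar P *m M *m P - mxstar Q *m M *m Q
    = mxstar P *m (M *m (P - Q)) + mxstar (mxstar Q *m (M *m (P - Q))).
  rewrite (mxstarM (mxstar Q) (M *m (P - Q))) (mxstarM M (P - Q)) (mxstarK Q) Msym.
  rewrite [mxstar (P - Q)]raddfB /= !mulmxBr !mulmxBl !mulmxA.
  by rewrite addrA subrK.
apply: (subspaceD subspace_sym_span).
  exact/sym_span_rows/rows_in_mulmx.
exact/sym_span_star/sym_span_rows/rows_in_mulmx.
Qed.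

End LeftModule.

(** * A strictly positive functional in bounded degree *)

Section CombForm.
Variables (R : realType) (g nu l : nat) (M : 'M[{ncpoly R[g]}]_nu).
Local Notation ncp := {ncpoly R[g]}.
Local Notation rho := (@monalg.mkmalgU (word g) R mone).

(** The coefficient matrix u^T w is what turns sums of squares into images of
    positive semidefinite matrices under a linear map. *)
Lemma comb_form n (f : 'I_n -> 'M[ncp]_(nu, l)) (u w : 'rV[R]_n) :
  mxstar (comb rho f u) *m M *m comb rho f w
  = lincomb rho (fun jk => mxstar (f jk.1) *m M *m f jk.2)
      (fun jk => (u^T *m w) jk.1 jk.2).
Proof.
rewrite /lincomb -(pair_big predT predT (fun j k =>
  ((u^T *m w) j k)%:MP *: (mxstar (f j) *m M *m f k))) /=.
rewrite /comb {1 2}/lincomb (raddf_sum (@mxstar R g nu l)) !mulmx_suml.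
apply: eq_bigr => j _ /=.
rewrite [LHS]mulmx_sumr; apply: eq_bigr => k _.
have -> : (u^T *m w) j k = w 0 k * u 0 j by rewrite mxE big_ord1 mxE mulrC.
rewrite [LHS]mulmx_malgC mxstarZ -!scalemxAl [LHS]scalerA.
by rewrite -(rmorphM rho).
Qed.

End CombForm.

Section Functional.
Variables (R : realType) (g l nu : nat) (L : 'M[{ncpoly R[g]}]_nu).
Variables (J : set 'rV[{ncpoly R[g]}]_l) (m : nat).
Hypotheses (pencilL : linear_pencil L) (LrealJ : Lreal L J).
Local Notation ncp := {ncpoly R[g]}.
Local Notation rho := (@monalg.mkmalgU (word g) R mone).

Lemma mxdeg_square (q : 'rV[ncp]_l) : mxdeg m q -> mxdeg (m + m).+1 (mxstar q *m q).
Proof.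
move=> qm; apply: (@mxdeg_le _ _ _ _ (m + m)) => //.
exact/mxdegM/qm/mxdeg_star.
Qed.

Lemma mxdeg_pencil : mxdeg 1 L.
Proof. by move=> i j w; apply: pencilL.2. Qed.

Lemma mxdeg_Lsquare (q : 'M[ncp]_(nu, l)) :
  mxdeg m q -> mxdeg (m + m).+1 (mxstar q *m L *m q).
Proof.
move=> qm; rewrite -addn1 addnAC.
exact: (mxdegM (mxdegM (mxdeg_star qm) mxdeg_pencil) qm).
Qed.

Lemma subspace_Lrows : subspace rho [set q : 'M[ncp]_(nu, l) | rows_in nu J (L *m q)].
Proof.
have [J0 JD] := subspace_rows_in LrealJ.1 nu.
split=> [|c x y Jx Jy] /=; first by rewrite mulmx0.
have -> : L *m (c%:MP *: x + y) = c%:MP *: (L *m x) + L *m y.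
  by rewrite mulmxDr (mulmx_malgC c L x).
exact: (JD c (L *m x) (L *m y) Jx Jy).
Qed.

(** Coordinates on the finite-dimensional quotient of the matrices of degree at
    most 2m+1 by the symmetric span.  They are extended to all matrices by
    dropping the monomials of higher degree, which keeps them linear. *)
Lemma linear_coord : exists M (kappa : 'M[ncp]_l -> 'rV[R]_M),
  [/\ forall c F G, kappa (c%:MP *: F + G) = c *: kappa F + kappa G &
      forall F, mxdeg (m + m).+1 F -> (kappa F = 0 <-> sym_span J F)].
Proof.
pose k := (m + m).+1; have subS := subspace_sym_span LrealJ.1.
have [M [f [_ free_f span_f]]] := basis_mod subS (@monomx R g l l k).
have /choice[kappa kappaP] : forall F : 'M[ncp]_l, exists d,
    sym_span J (lincomb rho (@monomx R g l l k) (monomx_coef F) - comb rho f d).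
  by move=> F; exact: span_f.
have kappa_uniq F d :
    sym_span J (lincomb rho (@monomx R g l l k) (monomx_coef F) - comb rho f d) ->
    kappa F = d.
  move=> Fd; apply/eqP; rewrite -subr_eq0; apply/eqP; apply: free_f.
  have := subspaceB subS Fd (kappaP F).
  by rewrite opprB addrC addrA subrK combB.
exists M, kappa; split=> [c F G|F Fk].
  apply: kappa_uniq.
  have -> : monomx_coef (k := k) (c%:MP *: F + G)
      = fun t => c * monomx_coef F t + monomx_coef G t.
    by apply/funext => t; rewrite /monomx_coef !mxE mcoeffD mcoeffCM.
  have := subS.2 c _ _ (kappaP F) (kappaP G).
  by rewrite lincomb_linear comb_linear scalerBr addrACA -opprD.
have := kappaP F; rewrite lincomb_monomx // => FS; split=> [F0|JF].
  by move: FS; rewrite F0 comb0 subr0.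
apply: free_f; have := subspaceB subS JF FS.
by rewrite opprB addrC subrK.
Qed.

(** The functionals from which the representation is built.  Degree 2m+1 is what
    is needed to pair a row of degree m with a letter times another such row,
    and to evaluate q^* L q for q of degree m. *)
Record Lstate (phi : 'M[ncp]_l -> R) : Prop := {
  Lstate_lin : forall c F G, phi (c%:MP *: F + G) = c * phi F + phi G;
  Lstate_star : forall F, phi (mxstar F) = phi F;
  Lstate_null : forall F, mxdeg (m + m).+1 F -> sym_span J F -> phi F = 0;
  Lstate_gt0 : forall q : 'rV_l, mxdeg m q -> ~ J q -> 0 < phi (mxstar q *m q);
  Lstate_L_ge0 : forall q : 'M_(nu, l),
    mxdeg m q -> 0 <= phi (mxstar q *m L *m q)
}.

Lemma Lstate_symmetrize (psi : 'M[ncp]_l -> R) :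
  (forall c F G, psi (c%:MP *: F + G) = c * psi F + psi G) ->
  (forall F, mxdeg (m + m).+1 F -> sym_span J F -> psi F = 0) ->
  (forall q : 'rV_l, mxdeg m q -> ~ J q -> 0 < psi (mxstar q *m q)) ->
  (forall q : 'M_(nu, l), mxdeg m q -> 0 <= psi (mxstar q *m L *m q)) ->
  Lstate (fun F => psi F + psi (mxstar F)).
Proof.
move=> psi_lin psi_null psi_gt0 psi_L; split=> [c F G|F|F Fm JF|q qm Jq|q qm].
- have -> : mxstar (c%:MP *: F + G) = c%:MP *: mxstar F + mxstar G.
    by rewrite [LHS]raddfD /= (mxstarZ c F).
  rewrite (psi_lin c F G) (psi_lin c (mxstar F) (mxstar G)); ring.
- by rewrite mxstarK addrC.
- by rewrite !psi_null ?addr0 //; [exact: mxdeg_star | exact: sym_span_star].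
- by rewrite (mxstarM (mxstar q) q) (mxstarK q) addr_gt0 // psi_gt0.
- have -> : mxstar (mxstar q *m L *m q) = mxstar q *m L *m q.
    by rewrite (mxstarM (mxstar q *m L) q) (mxstarM (mxstar q) L) (mxstarK q)
      pencilL.1 mulmxA.
  by rewrite addr_ge0 // psi_L.
Qed.

(** Squares p^* p and q^* L q of degree-m elements are parametrized, modulo the
    symmetric span, by the two diagonal blocks of a positive semidefinite
    matrix Z: one block for p modulo J, the other for q modulo the condition
    that the rows of L q lie in J.  If Z = G^T G is sent to 0, the rows of G
    give a sum of squares in the symmetric span, and L-reality makes every row
    zero.  So the separation lemma applies. *)
Lemma Lreal_state : exists phi, Lstate phi.
Proof.
have modJ := LrealJ.1; have subS := subspace_sym_span modJ.
have [M [kappa [kappa_lin kappa0]]] := linear_coord.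
have [n [a [a_mono free_a span_a]]] :=
  basis_mod (subspace_left_module modJ) (@monomx R g 1 l m).
have [r [b [b_mono free_b span_b]]] :=
  basis_mod subspace_Lrows (@monomx R g nu l m).
have a_deg c : mxdeg m (comb rho a c).
  by apply: mxdeg_comb => i; have [t ->] := a_mono i; exact: mxdeg_monomx.
have b_deg c : mxdeg m (comb rho b c).
  by apply: mxdeg_comb => i; have [t ->] := b_mono i; exact: mxdeg_monomx.
(* Only the diagonal blocks of Z enter, since weighted sums of squares contain
   no mixed products of p and q. *)
pose T (Z : 'M[R]_(n + r)) : 'M[ncp]_l :=
  lincomb rho (fun jk => mxstar (a jk.1) *m 1%:M *m a jk.2)
    (fun jk => ulsubmx Z jk.1 jk.2)
  + lincomb rho (fun jk => mxstar (b jk.1) *m L *m b jk.2)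
    (fun jk => drsubmx Z jk.1 jk.2).
have T_lin c Z W : T (c *: Z + W) = c%:MP *: T Z + T W.
  rewrite /T.
  have -> : (fun jk => ulsubmx (c *: Z + W) jk.1 jk.2)
      = fun jk => c * ulsubmx Z jk.1 jk.2 + ulsubmx W jk.1 jk.2.
    by apply/funext => jk; rewrite !mxE.
  have -> : (fun jk => drsubmx (c *: Z + W) jk.1 jk.2)
      = fun jk => c * drsubmx Z jk.1 jk.2 + drsubmx W jk.1 jk.2.
    by apply/funext => jk; rewrite !mxE.
  by rewrite !lincomb_linear [in RHS]scalerDr addrACA.
have T_sq (u : 'rV[R]_n) (w : 'rV[R]_r) : T ((row_mx u w)^T *m row_mx u w)
    = mxstar (comb rho a u) *m comb rho a u
      + mxstar (comb rho b w) *m L *m comb rho b w.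
  rewrite /T tr_row_mx mul_col_row block_mxKul block_mxKdr -!comb_form.
  by rewrite mulmx1.
have kT_lin : linear (kappa \o T).
  by move=> c Z W; rewrite /= T_lin kappa_lin.
pose kT : {linear 'M[R]_(n + r) -> 'rV[R]_M} :=
  HB.pack (kappa \o T) (GRing.isLinear.Build _ _ _ _ _ kT_lin).
have [|y yP] := @psd_separation _ _ _ kT.
  move=> G /= kG; pose u i := lsubmx (row i G); pose w i := rsubmx (row i G).
  have TG : T (G^T *m G) = \sum_i mxstar (comb rho a (u i)) *m comb rho a (u i)
      + \sum_i mxstar (comb rho b (w i)) *m L *m comb rho b (w i).
    have T0 : T 0 = 0.
      by have := T_lin (- 1) 0 0; rewrite scaler0 addr0 rmorphN rmorph1 scaleN1r addNr.
    have TD Z W : T (Z + W) = T Z + T W.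
      by have := T_lin 1 Z W; rewrite rmorph1 !scale1r.
    rewrite gram_rows (big_morph T TD T0) -big_split; apply: eq_bigr => i _ /=.
    by rewrite -{1 2}[row i G]hsubmxK T_sq.
  have Tdeg : mxdeg (m + m).+1 (T (G^T *m G)).
    rewrite TG; apply: mxdegD; apply: mxdeg_sum => i.
      exact/mxdeg_square/a_deg.
    exact/mxdeg_Lsquare/b_deg.
  have := (kappa0 _ Tdeg).1 kG; rewrite TG => /LrealJ.2[aJ bJ].
  apply/row_matrixP => i; rewrite row0 -[LHS]hsubmxK.
  have -> : lsubmx (row i G) = 0 := free_a (u i) (aJ i).
  have -> : rsubmx (row i G) = 0 := free_b (w i) (bJ i).
  exact: row_mx0.
have kappaB F G : kappa (F - G) = kappa F - kappa G.
  have := kappa_lin (- 1) G F.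
  by rewrite rmorphN rmorph1 !scaleN1r addrC => ->; rewrite addrC.
exists (fun F => (kappa F *m y) 0 0 + (kappa (mxstar F) *m y) 0 0).
apply: (@Lstate_symmetrize (fun F => (kappa F *m y) 0 0)).
- by move=> c F G; rewrite kappa_lin mulmxDl -scalemxAl !mxE.
- by move=> F Fdeg /(kappa0 F Fdeg) ->; rewrite mul0mx mxE.
- move=> q qm nJq.
  have [u uP] := span_a (monomx_coef q).
  rewrite lincomb_monomx // in uP.
  have u0 : u != 0.
    by apply: contra_notN nJq => /eqP u0; move: uP; rewrite u0 comb0 subr0.
  have u_neq0 : row_mx u (0 : 'rV[R]_r) != 0.
    by apply: contraNneq u0; rewrite -row_mx0 => /eq_row_mx[->].
  suff -> : kappa (mxstar q *m q) = kappa (T ((row_mx u 0)^T *m row_mx u 0)).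
    exact: yP.
  rewrite T_sq comb0 mulmx0 addr0; apply/eqP; rewrite -subr_eq0 -kappaB; apply/eqP.
  apply/kappa0; first by apply: mxdegB; apply: mxdeg_square.
  rewrite -[mxstar q]mulmx1 -[mxstar (comb _ _ _)]mulmx1.
  apply: sym_span_square => //; first exact: mxstar1.
  by rewrite mul1mx; apply/rows_in_row.
- move=> q qm; have [w wP] := span_b (monomx_coef q).
  rewrite lincomb_monomx //= in wP.
  suff -> : kappa (mxstar q *m L *m q)
      = kappa (T ((row_mx (0 : 'rV_n) w)^T *m row_mx 0 w)).
    have [->|w0] := eqVneq (row_mx (0 : 'rV_n) w) 0; last exact: ltW (yP _ w0).
    have kT0 : kappa (T 0) = 0 := linear0 kT.
    by rewrite mulmx0 kT0 mul0mx mxE.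
  rewrite T_sq comb0 mulmx0 add0r; apply/eqP; rewrite -subr_eq0 -kappaB; apply/eqP.
  apply/kappa0; first by apply: mxdegB; apply: mxdeg_Lsquare.
  by apply: sym_span_square => //; exact: pencilL.1.
Qed.

End Functional.

(** * The truncated GNS construction *)

Section GNS.
Variables (R : realType) (g l nu : nat) (L : 'M[{ncpoly R[g]}]_nu).
Variables (J : set 'rV[{ncpoly R[g]}]_l) (m : nat).
Local Notation ncp := {ncpoly R[g]}.
Local Notation rho := (@monalg.mkmalgU (word g) R mone).
Variable phi : 'M[ncp]_l -> R.
Hypotheses (pencilL : linear_pencil L) (modJ : left_module J).
Hypothesis state_phi : Lstate L J m phi.

Lemma phiD F G : phi (F + G) = phi F + phi G.
Proof. by have := Lstate_lin state_phi 1 F G; rewrite rmorph1 scale1r mul1r. Qed.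

Lemma phi0 : phi 0 = 0.
Proof. by apply: (addIr (phi 0)); rewrite -phiD !add0r. Qed.

Lemma phi_sum (T : Type) (r : seq T) (F : T -> 'M[ncp]_l) :
  phi (\sum_(i <- r) F i) = \sum_(i <- r) phi (F i).
Proof. exact: (big_morph phi phiD phi0). Qed.

Definition form (p q : 'rV[ncp]_l) : R := phi (mxstar p *m q).

Lemma formC p q : form p q = form q p.
Proof.
by rewrite /form -[LHS](Lstate_star state_phi) (mxstarM (mxstar p) q) (mxstarK p).
Qed.

Lemma form_lin p c q r : form p (c%:MP *: q + r) = c * form p q + form p r.
Proof. by rewrite /form mulmxDr (mulmx_malgC c _ q) (Lstate_lin state_phi). Qed.

Lemma formD p q r : form p (q + r) = form p q + form p r.
Proof. by rewrite /form mulmxDr phiD. Qed.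

Lemma formr0 p : form p 0 = 0.
Proof. by rewrite /form mulmx0 phi0. Qed.

Lemma form_sum p (T : Type) (r : seq T) (F : T -> 'rV[ncp]_l) :
  form p (\sum_(i <- r) F i) = \sum_(i <- r) form p (F i).
Proof. exact: (big_morph (form p) (formD p) (formr0 p)). Qed.

Lemma formZ p c q : form p (c%:MP *: q) = c * form p q.
Proof. by have := form_lin p c q 0; rewrite formr0 !addr0. Qed.

Lemma form_comb p n (f : 'I_n -> 'rV[ncp]_l) c :
  form p (comb rho f c) = \sum_k c 0 k * form p (f k).
Proof. by rewrite /comb /lincomb form_sum; apply: eq_bigr => k _; rewrite formZ. Qed.

Lemma form_scaleD p a q r : form p (a *: (q + r)) = form p (a *: q) + form p (a *: r).
Proof. exact: etrans (congr1 (form p) (scalerDr a q r)) (formD _ _ _). Qed.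

Lemma form_scale_comb p a n (f : 'I_n -> 'rV[ncp]_l) c :
  form p (a *: comb rho f c) = \sum_k c 0 k * form p (a *: f k).
Proof.
have -> : a *: comb rho f c = comb rho (fun k => a *: f k) c.
  by rewrite /comb /lincomb scaler_sumr; apply: eq_bigr => k _; exact: scale_malgC.
exact: form_comb.
Qed.

(** Left multiplication by a has left multiplication by a^* as its adjoint;
    this makes evaluation at the transposed matrices come out right. *)
Lemma form_scale p a q : form (a *: p) q = form p (ncstar a *: q).
Proof. exact: (congr1 phi (mulmx_star_scale a p q)). Qed.

Lemma form_null h h' p z : (h + h' <= (m + m).+1)%N -> mxdeg h p -> mxdeg h' z ->
  J z -> form p z = 0.
Proof.
move=> hh' ph zh' Jz; apply: (Lstate_null state_phi).
  by apply: mxdeg_le hh' _; apply: mxdegM => //; apply: mxdeg_star.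
by apply: (sym_span_rows modJ); apply: (rows_in_mulmx modJ); apply/rows_in_row.
Qed.

(** The Gram matrix of a basis modulo J is positive definite because phi is
    strictly positive on squares of elements outside J.  Its Cholesky factor is
    then invertible and orthonormalizes the basis. *)
Lemma orthonormal_basis : exists n (b : 'I_n -> 'rV[ncp]_l),
  [/\ forall j, mxdeg m (b j), forall j k, form (b j) (b k) = (j == k)%:R &
      forall q, mxdeg m q -> J (q - comb rho b (\row_k form (b k) q))].
Proof.
have [n [a [a_mono free_a span_a]]] :=
  basis_mod (subspace_left_module modJ) (@monomx R g 1 l m).
have a_deg1 i : mxdeg m (a i) by have [t ->] := a_mono i; exact: mxdeg_monomx.
have a_deg c : mxdeg m (comb rho a c) by exact: mxdeg_comb.
pose Phi := \matrix_(j, k) form (a j) (a k).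
have PhiE (u w : 'rV[R]_n) : form (comb rho a u) (comb rho a w) = (u *m Phi *m w^T) 0 0.
  rewrite mxE form_comb; apply: eq_bigr => k _; rewrite mulrC [w^T k 0]mxE.
  congr (_ * _); rewrite formC form_comb mxE; apply: eq_bigr => j _.
  by rewrite mxE formC.
have Phi_gt0 (u : 'rV[R]_n) : u != 0 -> 0 < (u *m Phi *m u^T) 0 0.
  move=> u0; rewrite -PhiE; apply: (Lstate_gt0 state_phi) => // /free_a u00.
  by rewrite u00 eqxx in u0.
have [|G GE] := @psd_gram R n Phi.
  split; first by apply/matrixP => j k; rewrite !mxE formC.
  move=> u; have [->|u0] := eqVneq u^T 0; first by rewrite !mul0mx mxE.
  by have := Phi_gt0 _ u0; rewrite trmxK => /ltW.
have G_unit : G^T \in unitmx.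
  rewrite -row_free_unit; apply: inj_row_free => u uG.
  apply/eqP; apply: contraT => /Phi_gt0.
  by rewrite GE mulmxA uG !mul0mx mxE ltxx.
pose H := invmx G^T.
exists n, (fun j => comb rho a (row j H)); split=> [j|j k|q qm]; first exact: a_deg.
  have GH : G *m (row k H)^T = (row k 1%:M)^T.
    by rewrite -[G]trmxK -trmx_mul -row_mul mulVmx.
  rewrite PhiE GE mulmxA -row_mul mulVmx // -mulmxA GH -row_mul mul1mx.
  by rewrite !mxE eq_sym.
have [d dP] := span_a (monomx_coef q).
rewrite (lincomb_monomx qm) in dP.
rewrite comb_comb; suff -> : (\row_k form (comb rho a (row k H)) q) *m H = d by [].
have -> : \row_k form (comb rho a (row k H)) q = d *m G^T.
  apply/rowP => k; rewrite mxE -[q](subrK (comb rho a d)) formD.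
  rewrite (@form_null m m) ?add0r //; last exact: mxdegB.
  rewrite PhiE GE mulmxA -row_mul mulVmx // -mulmxA -row_mul mul1mx.
  by rewrite [LHS]mxE -[d *m G^T]trmxK trmx_mul trmxK [RHS]mxE.
by rewrite -mulmxA mulmxV ?mulmx1.
Qed.

Section Representation.
Variables (n : nat) (b : 'I_n -> 'rV[ncp]_l).
Hypothesis b_deg : forall j, mxdeg m (b j).
Hypothesis b_orth : forall j k, form (b j) (b k) = (j == k)%:R.
Hypothesis b_span : forall q, mxdeg m q -> J (q - comb rho b (\row_k form (b k) q)).

(** The coordinates of the orthogonal projection of q to V / J, where V is the
    space of rows of degree at most m; q itself may have larger degree. *)
Definition gcoord (q : 'rV[ncp]_l) : 'cV[R]_n := \col_k form (b k) q.

Lemma gcoordE q : \row_k form (b k) q = (gcoord q)^T.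
Proof. by apply/rowP => k; rewrite !mxE. Qed.

Lemma gcoordZ c q : gcoord (c%:MP *: q) = c *: gcoord q.
Proof. by apply/colP => k; rewrite mxE formZ !mxE. Qed.

Lemma gcoord_sum (T : Type) (r : seq T) (F : T -> 'rV[ncp]_l) :
  gcoord (\sum_(i <- r) F i) = \sum_(i <- r) gcoord (F i).
Proof.
apply/colP => k; rewrite [LHS]mxE form_sum [RHS]summxE.
by apply: eq_bigr => i _; rewrite [RHS]mxE.
Qed.

Lemma gcoord_comb (c : 'rV[R]_n) : gcoord (comb rho b c) = c^T.
Proof.
apply/colP => k; rewrite mxE form_comb [RHS]mxE (bigD1 k) //= b_orth eqxx mulr1.
by rewrite big1 ?addr0 // => j /negPf jk; rewrite b_orth eq_sym jk mulr0.
Qed.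

Lemma gcoord_null q : mxdeg m q -> J q -> gcoord q = 0.
Proof.
by move=> qm Jq; apply/colP => k; rewrite !mxE (@form_null m m).
Qed.

(** Projecting z is harmless as long as the other argument has degree at most m:
    p differs from its expansion in the orthonormal basis by an element of J of
    degree m, which is orthogonal to everything of degree m+1. *)
Lemma form_gcoord p z : mxdeg m p -> mxdeg m.+1 z ->
  form p z = ((gcoord p)^T *m gcoord z) 0 0.
Proof.
move=> pm zm; rewrite formC -[p](subrK (comb rho b (gcoord p)^T)) formD.
rewrite (@form_null m.+1 m) ?add0r //.
- rewrite form_comb [RHS]mxE; apply: eq_bigr => k _.
  rewrite subrK formC; congr (_ * _).
  by rewrite [RHS]mxE.
- by apply: mxdegB => //; apply: mxdeg_comb.
- by rewrite -gcoordE; exact: b_span.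
Qed.

(** Multiplication by x_i compressed to the quotient by J. *)
Definition gns_tuple (i : 'I_g) : 'M[R]_n :=
  \matrix_(j, k) form (b j) (<< fmu (inl i) >> *: b k).

Lemma letter_gns x j k :
  letter_eval gns_tuple x j k = form (b j) (<< fmu x >> *: b k).
Proof.
case: x => i; first by rewrite [LHS]mxE.
rewrite [LHS]mxE [LHS]mxE formC (form_scale (b j) _ (b k)) ncstarU.
have -> // : word_star (fmu (inl i)) = fmu (inr i) :> word g.
by apply/eqP; rewrite fmP /= !fmU.
Qed.

(** Multiplication by a letter is well defined on the quotient because J is a left
    module; one letter raises the degree only to m+1, and phi
    still kills the products of total degree 2m+1 that arise from J. *)
Lemma letter_gcoord x q : mxdeg m q ->
  letter_eval gns_tuple x *m gcoord q = gcoord (<< fmu x >> *: q).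
Proof.
move=> qm; apply/colP => j; rewrite [LHS]mxE [RHS]mxE.
have J0 : form (b j) (<< fmu x >> *: (q - comb rho b (gcoord q)^T)) = 0.
  apply: (@form_null m m.+1) => //; first by rewrite addnS.
    rewrite -add1n; apply: mxdegZ; first by apply: ncdegU; rewrite fdegU.
    by apply: mxdegB => //; exact: mxdeg_comb.
  by apply: (left_moduleZ modJ); rewrite -gcoordE; exact: b_span.
have -> : form (b j) (<< fmu x >> *: q)
    = form (b j) (<< fmu x >> *: comb rho b (gcoord q)^T).
  have := form_scaleD (b j) << fmu x >> _ (comb rho b (gcoord q)^T).
  move=> /(_ (q - comb rho b (gcoord q)^T)) E.
  rewrite (subrK (comb rho b (gcoord q)^T) q) in E.
  exact: etrans E (etrans (congr1 (+%R^~ _) J0) (add0r _)).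
rewrite form_scale_comb; apply: eq_bigr => k _.
by rewrite letter_gns [_^T _ _]mxE mulrC.
Qed.

(** Only the last letter applied may leave degree m, hence the bound m+1. *)
Lemma word_gcoord w k q : (fdeg w + k <= m.+1)%N -> mxdeg k q ->
  word_eval gns_tuple w *m gcoord q = gcoord (<< w >> *: q).
Proof.
case: w => s; elim: s => [|x s IHs] sk qk.
  have -> : << FMonom [::] >> = 1 :> ncp by rewrite -fmoneE.
  by rewrite scale1r /word_eval big_nil mul1mx.
have -> : FMonom (x :: s) = mmul (fmu x) (FMonom s) :> word g.
  by apply/eqP; rewrite fmP fmM fmU.
have sk' : (size s + k <= m)%N := sk.
rewrite word_evalM -[1 in RHS]mulr1 -malgUM -scalerA -letter_gcoord.
  rewrite -(IHs (leqW sk') qk) mulmxA; congr (_ *m _ *m _).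
  by rewrite /word_eval fmU big_seq1.
by apply: (mxdeg_le sk'); apply: mxdegZ => //; apply: ncdegU.
Qed.

Lemma peval_gcoord a d k q : (d + k <= m.+1)%N -> ncdeg d a -> mxdeg k q ->
  peval gns_tuple a *m gcoord q = gcoord (a *: q).
Proof.
move=> dk ad qk; rewrite {2}[a]monalgE scaler_suml gcoord_sum /peval mulmx_suml.
rewrite big_seq [RHS]big_seq; apply: eq_bigr => w /ad wd.
have wk : (fdeg w + k <= m.+1)%N by apply: leq_trans dk; rewrite leq_add2r.
by rewrite -scalemxAl (word_gcoord wk qk) -gcoordZ scalerA malgUM mulr1 mul1m.
Qed.

(** The classes of the unit rows, stacked. *)
Definition gns_vector : 'cV[R]_(l * n) :=
  \col_h gcoord (delta_mx 0 (mxtens_unindex h).1) (mxtens_unindex h).2 0.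

Lemma block_gns_vector j : block gns_vector j = gcoord (delta_mx 0 j).
Proof. by apply/colP => k; rewrite [LHS]mxE [LHS]mxE mxtens_indexK. Qed.

Lemma mxeval_gns q : mxdeg m q -> block (mxeval gns_tuple q *m gns_vector) 0 = gcoord q.
Proof.
move=> qm; rewrite block_mxeval.
transitivity (gcoord (\sum_j q 0 j *: delta_mx 0 j)).
  rewrite gcoord_sum.
  apply: eq_bigr => j _; rewrite block_gns_vector.
  apply: (@peval_gcoord _ m 0); rewrite ?addn0 //.
  move=> i k; rewrite mxE; case: andP => _.
    by apply: ncdegU; rewrite fdeg1.
  exact: ncdeg0.
by rewrite -row_sum_delta.
Qed.

(** The blocks of u are coordinate vectors of the rows of some matrix q of
    degree m.  Because the entries of L have degree at most 1, applying L(X)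
    to u gives the coordinates of the rows of L q, and pairing these with the
    coordinates of the rows of q returns phi(q^* L q). *)
Lemma psd_gns : psdmx (mxeval gns_tuple L).
Proof.
split=> [|u]; first by rewrite -mxeval_star pencilL.1.
pose q : 'M[ncp]_(nu, l) := \matrix_i comb rho b (block u i)^T.
have qm : mxdeg m q by move=> i j; rewrite mxE; apply: mxdeg_comb.
have rowq i : row i q = comb rho b (block u i)^T by rewrite rowK.
suff -> : (u^T *m mxeval gns_tuple L *m u) 0 0 = phi (mxstar q *m L *m q).
  exact: (Lstate_L_ge0 state_phi).
transitivity (\sum_i ((block u i)^T *m block (mxeval gns_tuple L *m u) i) 0 0).
  rewrite -mulmxA mxE big_mxtens; apply: eq_bigr => i _.
  by rewrite mxE; apply: eq_bigr => k _; rewrite !mxE.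
transitivity (\sum_i form (row i q) (\sum_j L i j *: row j q)).
  apply: eq_bigr => i _; rewrite form_gcoord //.
  - rewrite rowq gcoord_comb trmxK; congr ((_ *m _) 0 0).
    rewrite block_mxeval gcoord_sum; apply: eq_bigr => j _.
    rewrite -(@peval_gcoord _ 1 m) //; first by rewrite rowq gcoord_comb trmxK.
      exact: (mxdeg_pencil pencilL).
    by rewrite rowq; apply: mxdeg_comb.
  - by rewrite rowq; apply: mxdeg_comb.
  - apply: mxdeg_sum => j; apply: (@mxdegZ _ _ _ _ 1 m).
      exact: (mxdeg_pencil pencilL).
    by rewrite rowq; apply: mxdeg_comb.
rewrite /form -phi_sum; congr phi.
have -> : mxstar q *m L *m q = mxstar q *m (L *m q) by rewrite mulmxA.
rewrite [RHS]mulmx_col_row; apply: eq_bigr => i _.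
have -> : col i (mxstar q) = mxstar (row i q) by rewrite /mxstar tr_row map_col.
by rewrite (row_mulmx L q i).
Qed.

End Representation.
End GNS.

(** * The Nullstellensatz *)

(** An L-real module is detected in bounded degree by one matrix point: the
    vector q(X) v is the class of q modulo J. *)
Lemma Lreal_representation (R : realType) (g l nu : nat)
    (L : 'M[{ncpoly R[g]}]_nu) (J : set 'rV[{ncpoly R[g]}]_l) (m : nat) :
  linear_pencil L -> Lreal L J ->
  exists n (X : 'I_g -> 'M[R]_n) (v : 'cV[R]_(l * n)),
    psdmx (mxeval X L) /\
    forall q : 'rV[{ncpoly R[g]}]_l, mxdeg m q -> (mxeval X q *m v = 0 <-> J q).
Proof.
move=> pencilL LrealJ; have modJ := LrealJ.1.
have [phi state_phi] := Lreal_state m pencilL LrealJ.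
have [n [b [b_deg b_orth b_span]]] := orthonormal_basis modJ state_phi.
exists n, (gns_tuple phi b), (gns_vector phi b).
split=> [|q qm]; first exact: (psd_gns pencilL modJ state_phi).
have qX := mxeval_gns modJ state_phi b_deg b_span qm.
split=> [q0|Jq].
  have q_coord0 : gcoord phi b q = 0.
    by rewrite -qX q0; apply/colP => k; rewrite !mxE.
  by have := b_span q qm; rewrite gcoordE q_coord0 trmx0 comb0 subr0.
apply: block_inj => i; rewrite (ord1 i) qX (gcoord_null modJ state_phi b_deg qm Jq).
by apply/colP => k; rewrite !mxE.
Qed.

Theorem proposition1p6 (R : realType) (g nu l : nat)
    (L : 'M[{ncpoly R[g]}]_nu) (I : set 'rV[{ncpoly R[g]}]_l)
    (p : 'rV[{ncpoly R[g]}]_l) :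
  linear_pencil L -> fg_left_module I ->
  (forall (n : nat) (X : 'I_g -> 'M[R]_n) (v : 'cV[R]_(l * n)),
      ncvariety I n (X, v) -> psdmx (mxeval X L) -> mxeval X p *m v = 0)
  <-> Lradical L I p.
Proof.
move=> pencilL [k [b ->]]; split=> [p0 J [LrealJ IJ]|radp n X v IXv psdL].
  have [db db_deg] := choice (fun i => mxdeg_ex (b i)).
  have [dp dp_deg] := mxdeg_ex p.
  pose m := maxn dp (\max_i db i)%N.
  have [n [X [v [psdL evalJ]]]] := Lreal_representation m pencilL LrealJ.
  have pm : mxdeg m p by apply: mxdeg_le dp_deg; exact: leq_maxl.
  apply/(evalJ p pm)/p0 => // _ [c ->].
  apply: (left_module_sum (eval_kernel_left_module X v)) => i.
  apply/evalJ.
    by apply: mxdeg_le (db_deg i); rewrite leq_max (leq_bigmax i) orbT.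
  apply: IJ; exists (fun j => (j == i)%:R).
  rewrite (bigD1 i) //= eqxx scale1r big1 ?addr0 // => j /negPf->.
  by rewrite scale0r.
by apply: (radp (eval_kernel X v)); split=> //; exact: eval_kernel_Lreal.
Qed.
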